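(* Let $p$ be a prime and let $G$ be a finite nonabelian $p$-group which is not minimal nonabelian. Then all minimal nonabelian subgroups of $G$ are isolated in $G$ if and only if $\exp(G)=p$.
   Context: A subgroup $H$ of a group $G$ is isolated in $G$ if for each $x\in G$ either $x\in H$ or $\langle x\rangle\cap H=\{1\}$. A group is minimal nonabelian if it is nonabelian and all of its proper subgroups are abelian. $\exp(G)$ denotes the exponent of $G$. *)

(* Defs.v *)
From mathcomp Require Import all_boot all_fingroup all_solvable.

Set Implicit Arguments.
Unset Strict Implicit.
Unset Printing Implicit Defensive.

Local Open Scope group_scope.

Definition isolated (gT : finGroupType) (H G : {group gT}) : Prop :=
  H \subset G /\ forall x : gT, x \in G -> x \in H \/ <[x]> :&: H = 1.

Definition minimal_nonabelian (gT : finGroupType) (G : {group gT}) : Prop :=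
  ~~ abelian G /\ forall K : {group gT}, K \proper G -> abelian K.

(* Main.v *)
Require Import Defs.
From mathcomp Require Import all_boot all_fingroup all_solvable.

(** If G has exponent p, then every nontrivial cyclic subgroup of G has prime
    order, so it lies in a given subgroup H or meets H trivially: every
    subgroup is isolated.

    Conversely, let every minimal nonabelian subgroup be isolated and suppose
    that G has an element whose p-th power is not 1. The case p odd rests on
    one fact ([exists_expg_coset_neq1]). Let U be a subgroup on which h |-> h^p
    is a homomorphism, not trivial, with abelian kernel W, and let x be an
    element outside U which normalises U. Then some hx with h in U has
    (hx)^p <> 1. Otherwise choose a in U such that c = a^p has order p and is
    centralised by x. Then [a,x] lies in W, so that modulo [W,x] the group
    W<x> becomes abelian and is normalised by a. Hence (a x)^p = a^p e and
    (a x^-1)^p = a^p e^-1 with the same e, and both being 1 gives a^(2p) = 1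
    modulo [W,x]. As p is odd, c = [y,x] for some y in W. A commutator which
    is central of order p makes <y,x> minimal nonabelian
    ([minimal_nonabelian_joing_cycle]); this subgroup contains c = a^p but not
    a, since W<x> meets U in W. So it is not isolated.

    The fact is used twice. With U = A, a maximal abelian subgroup of G which
    contains an element of p-th power <> 1, it yields u = hx in N(A) \ A with
    u^p <> 1; taking y in A with [y,u] central of order p in A<u>, the subgroup
    L = <y,u> is minimal nonabelian and has an element of p-th power <> 1.
    With U = L, which is proper because G is not minimal nonabelian, take x in
    N(L) \ L with x^p in L. All (hx)^p lie in L while hx does not, and L is
    isolated, so all (hx)^p are 1: a contradiction. If p = 2, any minimal
    nonabelian subgroup serves as L, and (hx)^2 = 1 for all h in L says that x
    inverts L, so that L is abelian, again a contradiction. *)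

Local Open Scope group_scope.

(** * Powers of a product with an element of a normalised abelian subgroup *)

(** The element e is a product of conjugates of x under powers of a; since E is
    abelian, replacing x by its inverse replaces this product by its
    inverse. *)

Lemma expgM_norm_abelian (gT : finGroupType) (E : {group gT}) (a x : gT) n :
    abelian E -> a \in 'N(E) -> x \in E ->
  exists2 e, e \in E & (a * x) ^+ n = a ^+ n * e /\
                       (a * x^-1) ^+ n = a ^+ n * e^-1.
Proof.
move=> cEE nEa Ex; elim: n => [|n [e Ee [IH1 IH2]]].
  by exists 1; rewrite ?group1 // !expg0 invg1 mulg1.
have Eea : e ^ a \in E by rewrite memJ_norm.
exists (e ^ a * x); first by rewrite groupM.
have cxe : commute x (e ^ a) by exact: (centsP cEE).
rewrite !expgSr {}IH1 {}IH2 -!(mulgA (a ^+ n)).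
split; congr (_ * _); rewrite mulgA (conjgC _ a) -(mulgA a) //.
by rewrite conjVg -invMg cxe.
Qed.

Lemma expg2_eq1_norm_abelian (gT : finGroupType) (E : {group gT})
    (a x : gT) n :
    abelian E -> a \in 'N(E) -> x \in E ->
  (a * x) ^+ n = 1 -> (a * x^-1) ^+ n = 1 -> (a ^+ n) ^+ 2 = 1.
Proof.
move=> cEE nEa Ex ax1 axV1.
have [e _ []] := expgM_norm_abelian gT E a x n cEE nEa Ex.
rewrite ax1 axV1 => /esym ane /esym/eqP; rewrite -eq_mulgV1 => /eqP ae.
by rewrite expgS expg1 {2}ae.
Qed.

(** * Minimal nonabelian p-groups *)

Lemma abelem_joing_cycle (gT : finGroupType) p (u v : gT) :
    prime p -> commute u v -> u ^+ p = 1 -> v ^+ p = 1 ->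
  p.-abelem (<[u]> <*> <[v]>).
Proof.
move=> p_pr cuv up1 vp1.
have cvu : <[v]> \subset 'C(<[u]>).
  by rewrite cycle_subG /= cent_cycle; apply/cent1P.
have abE (w : gT) : w ^+ p = 1 -> p.-abelem <[w]>.
  move=> wp1; rewrite abelemE // cycle_abelian exponent_cycle.
  by rewrite order_dvdn wp1 eqxx.
by rewrite (cprod_abelem _ (cprodEY cvu)) !abE.
Qed.

Lemma card_joing_cycle_leq (gT : finGroupType) p (u v : gT) :
    prime p -> commute u v -> u ^+ p = 1 -> v ^+ p = 1 ->
  #|<[u]> <*> <[v]>| <= p ^ 2.
Proof.
move=> p_pr cuv up1 vp1.
have cvu : <[v]> \subset 'C(<[u]>).
  by rewrite cycle_subG /= cent_cycle; apply/cent1P.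
have ole (w : gT) : w ^+ p = 1 -> #|<[w]>| <= p.
  move=> wp1; apply: dvdn_leq; first exact: prime_gt0.
  by rewrite -orderE order_dvdn wp1.
rewrite cent_joinEr // -mulnn.
apply: leq_trans (leq_mul (ole _ up1) (ole _ vp1)).
by rewrite mul_cardG leq_pmulr // cardG_gt0.
Qed.

(** With a central commutator of order p, the p-th powers of the generators are
    central too, so the Frattini subgroup is central; it has index at most p^2
    because there are two generators. If K is nonabelian, then K Phi / Phi is
    not cyclic, so it has order p^2, whence K Phi is the whole group and, as
    Phi consists of nongenerators, so is K. *)
Lemma minimal_nonabelian_joing_cycle (gT : finGroupType) p (x y : gT) :
    prime p -> p.-group (<[x]> <*> <[y]>) ->
    [~ x, y] != 1 -> [~ x, y] ^+ p = 1 ->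
    commute [~ x, y] x -> commute [~ x, y] y ->
  minimal_nonabelian (<[x]> <*> <[y]>)%G.
Proof.
move=> p_pr; set H := (_ <*> _)%G => pH nz zp1 czx czy.
have Hx : x \in H by rewrite -cycle_subG joing_subl.
have Hy : y \in H by rewrite -cycle_subG joing_subr.
have inZ w : w \in H -> commute w x -> commute w y -> w \in 'Z(H).
  move=> Hw cwx cwy; rewrite !in_setI Hw centY !cent_cycle in_setI andTb.
  by apply/andP; split; apply/cent1P/commute_sym.
have Zz : [~ x, y] \in 'Z(H) by rewrite inZ ?groupR.
have Zxp : x ^+ p \in 'Z(H).
  apply: inZ; rewrite ?groupX //; first exact/commute_sym/commuteX.
  by apply/commgP; rewrite commXg ?zp1 //; apply: commute_sym.
have Zyp : y ^+ p \in 'Z(H).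
  apply: inZ; rewrite ?groupX //; last exact/commute_sym/commuteX.
  by apply/commute_sym/commgP; rewrite commgX ?zp1 //; apply: commute_sym.
have nHx : x \in 'N('Z(H)) by apply: subsetP Hx; rewrite gFnorm.
have nHy : y \in 'N('Z(H)) by apply: subsetP Hy; rewrite gFnorm.
have PhiZ : 'Phi(H) \subset 'Z(H).
  apply: (Phi_min pH); rewrite ?gFnorm //.
  rewrite quotientY ?cycle_subG // !quotient_cycle //.
  apply: abelem_joing_cycle => //; last 2 first.
  - by rewrite -morphX //= coset_id.
  - by rewrite -morphX //= coset_id.
  by apply/commgP; rewrite -morphR //= coset_id.
have leHPhi : #|H / 'Phi(H)| <= p ^ 2.
  have nPx : x \in 'N('Phi(H)) by apply: subsetP Hx; rewrite gFnorm.
  have nPy : y \in 'N('Phi(H)) by apply: subsetP Hy; rewrite gFnorm.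
  have abQ := Phi_quotient_abelem pH.
  have [_ Q1] := abelemP p_pr abQ.
  rewrite quotientY ?cycle_subG // !quotient_cycle //.
  apply: card_joing_cycle_leq; rewrite ?Q1 ?mem_quotient //.
  by apply: (centsP (abelem_abelian abQ)); rewrite mem_quotient.
split.
  apply: contra nz => /centsP cHH; apply/commgP; exact: cHH.
move=> K /andP[sKH not_sHK]; apply: contraR not_sHK => ncK.
have sKPhi : K <*> 'Phi(H) \subset H by rewrite join_subG sKH Phi_sub.
have sPKQ : K <*> 'Phi(H) / 'Phi(H) \subset H / 'Phi(H) by apply: quotientS.
have pKQ : p.-group (K <*> 'Phi(H) / 'Phi(H)).
  by apply: pgroupS sPKQ (quotient_pgroup _ pH).
have ltpKQ : p < #|K <*> 'Phi(H) / 'Phi(H)|.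
  rewrite ltnNge; apply: contra ncK => leKp.
  apply: abelianS (joing_subl K 'Phi(H)) _.
  apply: (@cyclic_factor_abelian _ 'Phi(H)).
    rewrite subsetI joing_subr (subset_trans PhiZ) //.
    by rewrite (subset_trans (subsetIr _ _)) // centS.
  have [->|ntQ] := eqVneq (K <*> 'Phi(H) / 'Phi(H)) 1; first exact: cyclic1.
  have [_ dvp _] := pgroup_pdiv pKQ ntQ.
  apply: prime_cyclic; suff -> : #|K <*> 'Phi(H) / 'Phi(H)| = p by [].
  by apply/eqP; rewrite eqn_leq leKp dvdn_leq ?cardG_gt0.
have eqQ : K <*> 'Phi(H) / 'Phi(H) = H / 'Phi(H).
  apply/eqP; rewrite eqEcard sPKQ (leq_trans leHPhi) //.
  move: ltpKQ; have [k ->] := p_natP pKQ.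
  have p_gt1 := prime_gt1 p_pr.
  by rewrite -{1}(expn1 p) ltn_exp2l // leq_exp2l.
have eqH : K <*> 'Phi(H) = H.
  apply: quotient_inj eqQ; last exact: Phi_normal.
  by rewrite /normal joing_subr (subset_trans sKPhi) ?gFnorm.
have := @Phi_nongen _ H K.
by rewrite joingC => /(_ eqH); rewrite genGid => ->.
Qed.

(** For h in L the subgroup <h> Phi(L) is proper, hence abelian: otherwise L
    would be the cyclic group <h>. *)
Lemma minimal_nonabelian_Phi_center (gT : finGroupType) (L : {group gT}) :
  minimal_nonabelian L -> 'Phi(L) \subset 'Z(L).
Proof.
case=> ncL abL; rewrite subsetI Phi_sub; apply/centsP=> z Phiz h Lh.
have : <[h]> <*> 'Phi(L) \proper L.
  rewrite properEneq join_subG cycle_subG Lh Phi_sub !andbT.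
  apply: contra ncL => /eqP defL.
  have <- := @Phi_nongen _ L <[h]>; first by rewrite genGid cycle_abelian.
  by rewrite joingC.
move/abL/centsP; apply; first exact: (subsetP (joing_subr _ _)).
by rewrite -cycle_subG joing_subl.
Qed.

(** Commutators and p-th powers lie in the Frattini subgroup, so they are
    central. Thus L has class 2 and [k,h]^p = [k^p,h] = 1, and the correction
    term [k,h]^(p(p-1)/2) vanishes because p is odd. *)
Lemma expgM_minimal_nonabelian (gT : finGroupType) (L : {group gT}) p :
    prime p -> odd p -> p.-group L -> minimal_nonabelian L ->
  {in L &, {morph (fun h => h ^+ p) : h k / h * k}}.
Proof.
move=> p_pr odd_p pL minL h k Lh Lk.
have PhiZ := minimal_nonabelian_Phi_center gT L minL.
have PhiE := Phi_joing pL.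
have ZR u v : u \in L -> v \in L -> [~ u, v] \in 'Z(L).
  move=> Lu Lv; apply: (subsetP PhiZ); rewrite PhiE.
  by apply: (subsetP (joing_subl _ _)); apply: mem_commg.
have Zp u : u \in L -> u ^+ p \in 'Z(L).
  move=> Lu; apply: (subsetP PhiZ); rewrite PhiE.
  apply: (subsetP (joing_subr _ _)); rewrite -{1}(expn1 p).
  exact: Mho_p_elt (mem_p_elt pL Lu).
have cR u v w : u \in L -> v \in L -> w \in L -> commute w [~ u, v].
  move=> Lu Lv Lw; case/centerP: (ZR u v Lu Lv) => _ cz.
  exact/commute_sym/cz.
rewrite expMg_Rmul; try exact: cR.
have Rp : [~ k, h] ^+ p = 1.
  rewrite -commXg; last exact: cR.
  by apply/eqP/commgP; case/centerP: (Zp k Lk) => _; apply.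
by rewrite bin2odd // expgM Rp expg1n mulg1.
Qed.

(** * The subgroup of commutators with a normalising element *)

(** Since [v w, x] = [v,x]^w [w,x] and W is abelian, w |-> [w,x] is an
    endomorphism of W, so its image needs no generation: every element of
    the subgroup [W,x] is a single commutator. *)
Lemma commg_image_normal (gT : finGroupType) (W : {group gT}) (x : gT) :
    abelian W -> x \in 'N(W) ->
  exists R : {group gT}, [/\ R :=: [set [~ w, x] | w in W], R \subset W
                           & R <| W <*> <[x]>].
Proof.
move=> cWW nWx; have Wcomm w : w \in W -> [~ w, x] \in W.
  by move=> Ww; rewrite commgEl groupM ?groupV ?memJ_norm.
have gR : group_set [set [~ w, x] | w in W].
  apply/group_setP; split.
    by apply/imsetP; exists 1; rewrite ?group1 ?comm1g.
  move=> _ _ /imsetP[v Wv ->] /imsetP[w Ww ->].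
  apply/imsetP; exists (v * w); rewrite ?groupM // commMgJ.
  congr (_ * _); apply/esym/conjg_fixP/commgP.
  by apply: (centsP cWW); rewrite ?Wcomm.
pose R := Group gR.
have sRW : R \subset W by apply/subsetP=> _ /imsetP[w Ww ->]; apply: Wcomm.
exists R; split=> //; rewrite /normal (subset_trans sRW) ?joing_subl //=.
rewrite join_subG cycle_subG.
rewrite (subset_trans (subset_trans cWW (centS sRW)) (cent_sub _)) /=.
rewrite inE; apply/subsetP=> _ /imsetP[_ /imsetP[w Ww ->] ->].
by apply/imsetP; exists (w ^ x); rewrite ?memJ_norm // conjRg (conjgE x) mulKg.
Qed.

(** Modulo [W,x], the subgroup W<x> is abelian and normalised by a, because
    [a,x] is in W. There the two equations give a^(2p) = 1, so [W,x] contains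
    the square of a^p, and a^p itself as p is odd. *)
Lemma expg_eq_commg_norm_abelian (gT : finGroupType) (W : {group gT})
    (p : nat) (a x : gT) :
    odd p -> abelian W -> a \in 'N(W) -> x \in 'N(W) -> [~ a, x] \in W ->
    (a ^+ p) ^+ p = 1 ->
    (a * x) ^+ p = 1 -> (a * x^-1) ^+ p = 1 ->
  exists2 y, y \in W & a ^+ p = [~ y, x].
Proof.
move=> odd_p cWW nWa nWx Wax app1 ax1 axV1.
have [R [RE sRW]] := commg_image_normal gT W x cWW nWx.
case/andP=> _; rewrite join_subG cycle_subG => /andP[nRW nRx].
have RW w : w \in W -> [~ w, x] \in R by move=> Ww; rewrite RE; apply: imset_f.
have Wxa : [~ x, a] \in W by rewrite -invg_comm groupV.
have xaE : x ^ a = x * [~ x, a] by rewrite commgEl mulKVg.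
(* As [x,a] is in the abelian group W, [w,x]^a = [w^a, x [x,a]] = [w^a, x]. *)
have nRa : a \in 'N(R).
  rewrite inE; apply/subsetP=> _ /imsetP[r + ->].
  rewrite RE => /imsetP[w Ww ->]; rewrite -RE.
  have Wwa : w ^ a \in W by rewrite memJ_norm.
  rewrite conjRg xaE commgMJ.
  have /commgP/eqP-> : commute (w ^ a) [~ x, a] by apply: (centsP cWW).
  by rewrite mul1g memJ_norm ?RW // (subsetP nRW).
have cEE : abelian ((W <*> <[x]>) / R).
  rewrite quotientY ?cycle_subG // quotient_cycle // abelianY.
  rewrite quotient_abelian // cycle_abelian cycle_subG.
  apply/centP=> _ /morphimP[w Nw Ww ->].
  have Rxw : [~ x, w] \in R by rewrite -invg_comm groupV RW.
  by apply/commgP; rewrite -morphR //= coset_id.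
have nEa : coset R a \in 'N((W <*> <[x]>) / R).
  apply: (subsetP (quotient_norm _ _)); apply: mem_quotient.
  rewrite inE conjYg -cycleJ join_subG (normP nWa) joing_subl cycle_subG xaE.
  apply: groupM; first by rewrite -cycle_subG joing_subr.
  exact: (subsetP (joing_subl _ _)).
have Ex : coset R x \in (W <*> <[x]>) / R.
  by rewrite mem_quotient // -cycle_subG joing_subr.
have := @expg2_eq1_norm_abelian _ _ _ (coset R x) p cEE nEa Ex.
rewrite -!morphV // -!morphM ?groupV // -!morphX ?groupX ?groupM ?groupV //.
rewrite ax1 axV1 morph1 => /(_ erefl erefl)/coset_idr Rc2.
suff : a ^+ p \in R by rewrite RE; case/imsetP=> y Wy ->; exists y.
suff <- : ((a ^+ p) ^+ 2) ^+ p.+1./2 = a ^+ p.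
  by rewrite groupX // Rc2 // !groupX.
by rewrite -expgM mul2n even_halfK ?expgS ?app1 ?mulg1 //= odd_p.
Qed.

(** * The coset of an element normalising a subgroup *)

Lemma group_set_expg_eq1 (gT : finGroupType) (U : {group gT}) p :
    {in U &, {morph (fun h => h ^+ p) : h k / h * k}} ->
  group_set [set h in U | h ^+ p == 1].
Proof.
move=> powM; apply/group_setP; split; first by rewrite inE group1 expg1n eqxx.
move=> h k; rewrite !inE => /andP[Uh /eqP h1] /andP[Uk /eqP k1].
by rewrite groupM //= powM // h1 k1 mulg1.
Qed.

(** If all p-th powers on the coset U x were 1, a p-th power c = a^p <> 1 of an
    element a of U would be a commutator [y,x] with y^p = 1, and the minimal
    nonabelian subgroup <y,x> would contain a^p but not a. *)
Lemma exists_expg_coset_neq1 (gT : finGroupType) (G U : {group gT}) (p : nat)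
    (x : gT) :
    prime p -> odd p -> p.-group G ->
    (forall H : {group gT},
       H \subset G -> minimal_nonabelian H -> isolated H G) ->
    U \subset G -> {in U &, {morph (fun h => h ^+ p) : h k / h * k}} ->
    {in U &, forall h k, h ^+ p = 1 -> k ^+ p = 1 -> commute h k} ->
    (exists2 a, a \in U & a ^+ p != 1) ->
    x \in G -> x \in 'N(U) -> x \notin U ->
  exists2 h, h \in U & (h * x) ^+ p != 1.
Proof.
move=> p_pr odd_p pG isoG sUG powM cW [a0 Ua0 a0p] Gx nUx U'x.
apply/exists_inP; apply: contraT; rewrite negb_exists_in => /forall_inP hx1.
have {}hx1 h : h \in U -> (h * x) ^+ p = 1.
  by move/hx1; rewrite negbK => /eqP.
have xp1 : x ^+ p = 1 by rewrite -[x]mul1g hx1.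
have hxV1 h : h \in U -> (h * x^-1) ^+ p = 1.
  move=> Uh; rewrite -[h * _]invgK expVgn invMg invgK.
  have -> : x * h^-1 = (h^-1 * x) ^ x^-1 by rewrite conjgE invgK mulgK.
  by rewrite -conjXg hx1 ?groupV // conj1g invg1.
pose W := Group (group_set_expg_eq1 gT U p powM).
have WP h : reflect (h \in U /\ h ^+ p = 1) (h \in W).
  by rewrite inE; apply: (iffP andP) => -[Uh /eqP].
have cWW : abelian W.
  by apply/centsP=> h /WP[Uh h1] k /WP[Uk k1]; apply: cW.
have nWN u : u \in 'N(U) -> u \in 'N(W).
  move=> nUu; rewrite inE; apply/subsetP=> _ /imsetP[w /WP[Uw w1] ->].
  by apply/WP; rewrite memJ_norm // -conjXg w1 conj1g.
(* P, the subgroup of p-th powers, is a nontrivial normal subgroup of the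
   p-group U<x>, so it meets the centre; this provides the element c. *)
have gP : group_set [set h ^+ p | h in U].
  apply/group_setP; split; first by apply/imsetP; exists 1; rewrite ?expg1n.
  move=> _ _ /imsetP[h Uh ->] /imsetP[k Uk ->].
  by apply/imsetP; exists (h * k); rewrite ?groupM // powM.
pose P := Group gP; pose Q := (U <*> <[x]>)%G.
have sQG : Q \subset G by rewrite join_subG sUG cycle_subG.
have sUQ : U \subset Q by apply: joing_subl.
have nPN u : u \in 'N(U) -> u \in 'N(P).
  move=> nUu; rewrite inE; apply/subsetP=> _ /imsetP[_ /imsetP[h Uh ->] ->].
  by apply/imsetP; exists (h ^ u); rewrite ?conjXg // memJ_norm.
have sPU : P \subset U by apply/subsetP=> _ /imsetP[h Uh ->]; rewrite groupX.
have nPQ : P <| Q.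
  rewrite /normal (subset_trans sPU) //=; apply/subsetP=> u Qu; apply: nPN.
  by apply: subsetP Qu; rewrite join_subG normG cycle_subG.
have ntP : P != 1 :> {set gT}.
  apply: contra a0p => /eqP P1; rewrite -in_set1 -[[set 1]]P1.
  exact: imset_f.
have pQ : p.-group Q := pgroupS sQG pG.
have ntPZ := meet_center_nil (pgroup_nil pQ) nPQ ntP.
have sPZQ : P :&: 'Z(Q) \subset Q by rewrite subIset // center_sub orbT.
have [_ dvp _] := pgroup_pdiv (pgroupS sPZQ pQ) ntPZ.
have [c /setIP[/imsetP[a Ua defc] Zc] oc] := Cauchy p_pr dvp.
have cp1 : c ^+ p = 1 by rewrite -oc expg_order.
have nt_c : c != 1 by rewrite -order_gt1 oc prime_gt1.
have Qx : x \in Q by rewrite -cycle_subG joing_subr.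
have ccx : commute c x by case/centerP: Zc => _; apply.
have Wc : c \in W by apply/WP; rewrite defc groupX -?defc.
have Wax : [~ a, x] \in W.
  apply/WP; rewrite commgEl groupM ?groupV ?memJ_norm //.
  rewrite powM ?groupV ?memJ_norm //.
  by rewrite expVgn -conjXg -defc conjgE ccx mulKg mulVg.
have nWa : a \in 'N(W) by apply: nWN; apply: subsetP Ua; apply: normG.
have nWx : x \in 'N(W) by apply: nWN.
have app1 : (a ^+ p) ^+ p = 1 by rewrite -defc.
have [y Wy] := expg_eq_commg_norm_abelian gT W p a x odd_p cWW nWa nWx Wax
  app1 (hx1 a Ua) (hxV1 a Ua).
rewrite -defc => cE.
pose M := (<[y]> <*> <[x]>)%G.
have sMG : M \subset G.
  rewrite join_subG !cycle_subG Gx andbT (subsetP sUG) //.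
  by case/WP: Wy.
have minM : minimal_nonabelian M.
  apply: (@minimal_nonabelian_joing_cycle _ p); rewrite -?cE //.
    exact: pgroupS sMG pG.
  exact: (centsP cWW).
have Mx : x \in M by rewrite -cycle_subG joing_subr.
have My : y \in M by rewrite -cycle_subG joing_subl.
have [_ /(_ a (subsetP sUG a Ua)) []] := isoG M sMG minM; last first.
  move/eqP; rewrite -subG1 => /subsetP/(_ c); rewrite !inE.
  by rewrite {1}defc mem_cycle cE groupR // -cE (negPf nt_c) => /(_ isT).
(* The element a is not in W, so it is not in M either, as W<x> meets U in W:
   here <x> meets U trivially because x has prime order. *)
have sMW : M \subset W <*> <[x]>.
  by rewrite genS // setSU // cycle_subG.
move/(subsetP sMW); rewrite norm_joinEr ?cycle_subG //.
case/mulsgP=> w _ Ww /cycleP[i ->] aE.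
have ox : #[x] = p.
  by apply: nt_prime_order => //; apply: contraNneq U'x => ->.
have xi1 : x ^+ i = 1.
  apply/eqP; rewrite -in_set1 -[[set 1]](@prime_TIg _ <[x]> U).
  - rewrite inE mem_cycle /= -(mulKg w (x ^+ i)) -aE groupM ?groupV //.
    by case/WP: Ww.
  - by rewrite -orderE ox.
  - by rewrite cycle_subG.
by case/WP: Ww => _ w1; move: nt_c; rewrite defc aE xi1 mulg1 w1 eqxx.
Qed.

(** * Minimal nonabelian subgroups and the exponent *)

Lemma exists_minimal_nonabelian_sub (gT : finGroupType) (G : {group gT}) :
    ~~ abelian G ->
  exists2 L : {group gT}, L \subset G & minimal_nonabelian L.
Proof.
move=> ncG.
have [L /mingroupP[ncL minL] sLG] :=
  @mingroup_exists _ (fun H => ~~ abelian H) G ncG.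
exists L => //; split=> // K /andP[sKL not_sLK].
by apply: contraR not_sLK => ncK; rewrite (minL K ncK sKL).
Qed.

(** If p = 2, a group in which all squares are 1 is abelian, so any minimal
    nonabelian subgroup will do. If p is odd, the element u outside a maximal
    abelian subgroup A does not centralise A, and [A,u] contains a central
    element of order p of A<u>; it is a commutator [y,u] with y in A, and u
    lies in <y,u>. *)
Lemma exists_minimal_nonabelian_expg_neq1 (gT : finGroupType) (G : {group gT})
    (p : nat) :
    prime p -> p.-group G -> ~~ abelian G ->
    (forall H : {group gT},
       H \subset G -> minimal_nonabelian H -> isolated H G) ->
    (exists2 g, g \in G & g ^+ p != 1) ->
  exists L : {group gT}, [/\ L \subset G, minimal_nonabelian L
                           & exists2 h, h \in L & h ^+ p != 1].
Proof.
move=> p_pr pG ncG isoG [g Gg gp].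
have [p2 | odd_p] := even_prime p_pr.
  have [L sLG minL] := exists_minimal_nonabelian_sub gT G ncG.
  exists L; split=> //; apply/exists_inP; case: minL => ncL _.
  apply: contraR ncL; rewrite negb_exists_in => /forall_inP L1.
  apply: (@abelem_abelian _ 2); apply: exponent2_abelem; apply/exponentP=> h Lh.
  by move/L1: Lh; rewrite negbK p2 => /eqP.
pose abG (H : {group gT}) := (H \subset G) && abelian H.
have abg : abG <[g]>%G by rewrite /abG cycle_subG Gg cycle_abelian.
have [A /maxgroupP[/andP[sAG cAA] maxA] sgA] := maxgroup_exists abg.
have Ag : g \in A by rewrite -cycle_subG.
have prA : A \proper G.
  by rewrite properE sAG; apply: contra ncG => sGA; apply: abelianS sGA cAA.
have [_ [x /setIP[Gx nAx] A'x]] :=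
  properP (nilpotent_proper_norm (pgroup_nil pG) prA).
have [|||h Ah uP] :=
  exists_expg_coset_neq1 gT G A p x p_pr odd_p pG isoG sAG _ _ _ Gx nAx A'x.
- by move=> h k Ah Ak; apply: expgMn; apply: (centsP cAA).
- by move=> h k Ah Ak _ _; apply: (centsP cAA).
- by exists g.
set u := h * x in uP.
have Gu : u \in G by rewrite groupM // (subsetP sAG).
have A'u : u \notin A by rewrite groupMl.
have nAu : u \in 'N(A) by rewrite groupM // (subsetP (normG A)).
have sBG : A <*> <[u]> \subset G by rewrite join_subG sAG cycle_subG.
have [R [RE sRA nR]] := commg_image_normal gT A u cAA nAu.
have ntR : R :!=: 1.
  apply: contra A'u => /eqP R1.
  have <- : (A <*> <[u]>)%G = A; last by rewrite -cycle_subG joing_subr.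
  apply/val_inj/maxA; last exact: joing_subl.
  rewrite /abG sBG abelianY cAA cycle_abelian cycle_subG.
  apply/centP=> y Ay; apply/commute_sym/commgP; rewrite -in_set1 -[[set 1]]R1.
  by rewrite RE; apply: imset_f.
have pB : p.-group (A <*> <[u]>) := pgroupS sBG pG.
have ntRZ := meet_center_nil (pgroup_nil pB) nR ntR.
have pRZ : p.-group (R :&: 'Z(A <*> <[u]>)).
  by apply: pgroupS pB; rewrite subIset // center_sub orbT.
have [_ dvp _] := pgroup_pdiv pRZ ntRZ.
have [z /setIP[]] := Cauchy p_pr dvp.
rewrite {1}RE => /imsetP[y Ay ->] /centerP[_ cz] oz.
have My : y \in A <*> <[u]> by apply: subsetP Ay; apply: joing_subl.
have Mu : u \in A <*> <[u]> by rewrite -cycle_subG joing_subr.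
have sMG : <[y]> <*> <[u]> \subset G.
  by rewrite join_subG !cycle_subG Gu (subsetP sAG).
exists (<[y]> <*> <[u]>)%G; split=> //.
  apply: (@minimal_nonabelian_joing_cycle _ p) => //; try exact: cz.
  - exact: pgroupS sMG pG.
  - by rewrite -order_gt1 oz prime_gt1.
  - by rewrite -oz expg_order.
by exists u => //; rewrite -cycle_subG joing_subr.
Qed.

(** Given a proper minimal nonabelian subgroup L with an element of p-th power
    <> 1 and x in N(L) \ L with x^p in L, isolation of L makes all p-th powers
    on the coset L x trivial. For p odd this is impossible, and for p = 2 it
    means that x inverts L. *)
Lemma exponent_isolated_minimal_nonabelian (gT : finGroupType)
    (G : {group gT}) (p : nat) :
    prime p -> p.-group G -> ~~ abelian G -> ~ minimal_nonabelian G ->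
    (forall H : {group gT},
       H \subset G -> minimal_nonabelian H -> isolated H G) ->
  exponent G %| p.
Proof.
move=> p_pr pG ncG not_minG isoG; apply/exponentP=> g Gg.
apply/eqP/contraT => gp.
have [|L [sLG minL [a La ap]]] :=
  exists_minimal_nonabelian_expg_neq1 gT G p p_pr pG ncG isoG; first by exists g.
have prL : L \proper G.
  rewrite properEneq sLG andbT; apply/negP=> /eqP/group_inj eqLG.
  by apply: not_minG; rewrite -eqLG.
have pL : p.-group L := pgroupS sLG pG.
have pN : p.-group 'N_G(L) := pgroupS (subsetIl _ _) pG.
have [x [Gx nLx L'x Lxp]] :
    exists x, [/\ x \in G, x \in 'N(L), x \notin L & x ^+ p \in L].
  have ntQ : 'N_G(L) / L != 1.
    rewrite -subG1 quotient_sub1 ?subsetIr //.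
    by case/andP: (nilpotent_proper_norm (pgroup_nil pG) prL).
  have [_ dvp _] := pgroup_pdiv (quotient_pgroup L pN) ntQ.
  have [_ /morphimP[x nLx /setIP[Gx _] ->] ox] := Cauchy p_pr dvp.
  exists x; split=> //.
    apply: contraL (prime_gt1 p_pr) => Lx.
    by rewrite -ox /= coset_id // order1.
  by rewrite coset_idr ?groupX // morphX //= -ox expg_order.
have hxp h : h \in L -> (h * x) ^+ p = 1.
  move=> Lh; have nLh : h \in 'N(L) by rewrite (subsetP (normG L)).
  have Ghx : h * x \in G by rewrite groupM // (subsetP sLG).
  have [_ /(_ _ Ghx)] := isoG L sLG minL.
  rewrite groupMl // (negPf L'x) => -[//|TI].
  apply/eqP; rewrite -in_set1 -[[set 1]]TI inE mem_cycle /=.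
  apply: coset_idr; first by rewrite groupX ?groupM.
  rewrite morphX ?groupM //= morphM //= (coset_id Lh) mul1g.
  by rewrite -morphX //= coset_id.
have [p2 | odd_p] := even_prime p_pr.
  case: minL => ncL _; case/negP: ncL.
  have invx h : h \in L -> h ^ x = h^-1.
    move=> Lh; have x2 : x^-1 = x.
      by apply/eqP; rewrite eq_invg_mul -[x * x]/(x ^+ 2) -p2 -[x]mul1g hxp.
    apply/eqP; rewrite eq_sym eq_invg_mul conjgE x2 !mulgA -mulgA.
    by rewrite -[_ * _]/((h * x) ^+ 2) -p2 hxp.
  apply/centsP=> h Lh k Lk; apply: invg_inj.
  by rewrite -invx ?groupM // conjMg !invx // -invMg.
have powM := expgM_minimal_nonabelian gT L p p_pr odd_p pL minL.
pose W := Group (group_set_expg_eq1 gT L p powM).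
have cWW : abelian W.
  case: minL => _; apply; apply/properP; split.
    by apply/subsetP=> h /setIdP[].
  by exists a => //; rewrite inE (negPf ap) andbF.
have [||h Lh] :=
  exists_expg_coset_neq1 gT G L p x p_pr odd_p pG isoG sLG powM _ _ Gx nLx L'x.
- move=> h k Lh Lk h1 k1.
  by apply: (centsP cWW); rewrite inE ?Lh ?Lk ?h1 ?k1 eqxx.
- by exists a.
by rewrite hxp // eqxx.
Qed.

Theorem theorem7 (gT : finGroupType) (G : {group gT}) (p : nat) :
  prime p -> p.-group G -> ~~ abelian G -> ~ minimal_nonabelian G ->
  ((forall H : {group gT}, H \subset G -> minimal_nonabelian H -> isolated H G)
   <-> exponent G = p).
Proof.
move=> p_pr pG ncG not_minG; split=> [isoG | expG H sHG _].
  have [_ dvd_p] := primeP p_pr.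
  have /dvd_p/orP[/eqP exp1 | /eqP//] :=
    exponent_isolated_minimal_nonabelian gT G p p_pr pG ncG not_minG isoG.
  case/negP: ncG.
  by have /eqP-> : G :==: 1; rewrite ?trivg_exponent ?exp1 ?abelian1.
split=> // x Gx; have [Hx | H'x] := boolP (x \in H); [by left | right].
apply: prime_TIg; last by rewrite cycle_subG.
suff -> : #|<[x]>| = p by [].
apply: nt_prime_order => //; last by apply: contraNneq H'x => ->.
by apply/eqP; rewrite -order_dvdn -expG dvdn_exponent.
Qed.
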